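(* Let $p\ge 2$ be an integer, $f(u)=\frac1p u^p$, and consider $u_t-u_{xxt}+f(u)_x+u_x=f(u)_{xxx}$ on $I=[a,b]$ with periodic boundary conditions. Let $u_h,r_h,w_h,p_h,s_h$ (time-dependent, with values in $V_h^k$) be a solution of the semi-discrete local discontinuous Galerkin (LDG) scheme described in the context. Then: (i) for Scheme $\mathcal{D}2$, $$\frac{d}{dt}E_1(u_h)=\frac{d}{dt}\int_I w_h\,dx=0,\qquad \frac{d}{dt}E_2(u_h)=\frac{d}{dt}\int_I u_h^2\,dx\le 0;$$ (ii) for Scheme $\mathcal{C}2$, $$\frac{d}{dt}E_1(u_h)=\frac{d}{dt}\int_I w_h\,dx=0,\qquad \frac{d}{dt}E_2(u_h)=\frac{d}{dt}\int_I u_h^2\,dx=0.$$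
   Context: Mesh and space: $a=x_{1/2}<x_{3/2}<\dots<x_{N+1/2}=b$, $I_j=[x_{j-1/2},x_{j+1/2}]$, $V_h^k=\{v: v|_{I_j}\in P^k(I_j),\ 1\le j\le N\}$, where $P^k(I_j)$ is the set of polynomials of degree at most $k$ on $I_j$ (functions may be discontinuous across cell interfaces). $u^-_{j+1/2}$, $u^+_{j+1/2}$ are the traces at $x_{j+1/2}$ from $I_j$ and $I_{j+1}$ respectively (with periodic identification at the endpoints). Jump: $[u]=u^+-u^-$; average: $\{u\}=\frac12(u^++u^-)$. Also $(u,v)_{I_j}=\int_{I_j}uv\,dx$ and $\langle\hat u,v\rangle_{I_j}=\hat u_{j+1/2}v^-_{j+1/2}-\hat u_{j-1/2}v^+_{j-1/2}$. LDG scheme (based on $w=u-u_{xx}$, $w_t+f(u)_x+u_x=f(u)_{xxx}$): find $u_h,r_h,w_h,p_h,s_h\in V_h^k$ such that for all $j$ and all test functions $\phi,\psi,\varphi,\vartheta,\sigma\in V_h^k$, $$(u_h,\phi)_{I_j}-\langle\widehat{r_h},\phi\rangle_{I_j}+(r_h,\phi_x)_{I_j}=(w_h,\phi)_{I_j},$$ $$(r_h,\psi)_{I_j}-\langle\widehat{u_h},\psi\rangle_{I_j}+(u_h,\psi_x)_{I_j}=0,$$ $$((w_h)_t,\varphi)_{I_j}+(s_h,\varphi)_{I_j}=\langle\widehat{p_h},\varphi\rangle_{I_j}-(p_h,\varphi_x)_{I_j},$$ $$(p_h,\vartheta)_{I_j}=\langle\widehat{s_h},\vartheta\rangle_{I_j}-(s_h,\vartheta_x)_{I_j}-(u_h,\vartheta)_{I_j},$$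 $$(s_h,\sigma)_{I_j}=\langle\widehat{f(u_h)},\sigma\rangle_{I_j}-(f(u_h),\sigma_x)_{I_j}.$$ Scheme $\mathcal{D}2$ uses the Godunov flux $\widehat{f(u_h)}=\min_{u_h^-\le w\le u_h^+}f(w)$ if $u_h^-<u_h^+$ and $\widehat{f(u_h)}=\max_{u_h^+\le w\le u_h^-}f(w)$ if $u_h^+\le u_h^-$, together with $\widehat{u_h}=u_h^+$, $\widehat{r_h}=r_h^-$, $\widehat{s_h}=s_h^+$, $\widehat{p_h}=p_h^-$. Scheme $\mathcal{C}2$ uses $\widehat{f(u_h)}=[F(u_h)]/[u_h]$ if $[u_h]\ne0$ and $\widehat{f(u_h)}=f(\{u_h\})$ if $[u_h]=0$, where $F(u)=\int^u f(\tau)\,d\tau$ (equivalently $\widehat{f(u_h)}=\frac{1}{p(p+1)}\sum_{m=0}^p (u_h^+)^{p-m}(u_h^-)^m$), together with $\widehat{u_h}=\{u_h\}$, $\widehat{r_h}=\{r_h\}$, $\widehat{s_h}=\{s_h\}$, $\widehat{p_h}=\{p_h\}$. The continuous quantities are $E_1(u)=\int_I(u-u_{xx})\,dx$ and $E_2(u)=\int_I u^2\,dx$; at the discrete level $E_1(u_h)$ denotes $\int_I w_h\,dx$. *)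

(* Defs.v *)
From HB Require Import structures.
From mathcomp Require Import all_boot all_order all_algebra.
From mathcomp Require Import all_classical all_reals all_analysis.

Set Implicit Arguments.
Unset Strict Implicit.
Unset Printing Implicit Defensive.

Import Order.TTheory GRing.Theory Num.Theory.
Import numFieldNormedType.Exports.

Local Open Scope classical_set_scope.
Local Open Scope ring_scope.

(* The nodes x_{1/2} < ... < x_{N+1/2} are x 0 < ... < x N. *)
Definition is_mesh (R : realType) (a b : R) (N : nat) (x : 'I_N.+1 -> R) : Prop :=
  [/\ x ord0 = a, x ord_max = b & forall i j : 'I_N.+1, (i < j)%N -> x i < x j].

Definition xl (R : realType) (N : nat) (x : 'I_N.+1 -> R) (j : 'I_N) : R :=
  x (widen_ord (leqnSn N) j).

Definition xr (R : realType) (N : nat) (x : 'I_N.+1 -> R) (j : 'I_N) : R :=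
  x (lift ord0 j).

Definition cell (R : realType) (N : nat) (x : 'I_N.+1 -> R) (j : 'I_N) : set R :=
  `[xl x j, xr x j]%classic.

(* V_h^k: an element is given by its restrictions v|_{I_j} in P^k(I_j), one
   polynomial of degree at most k (size at most k.+1) per cell, so that it is
   two-valued at the interfaces. *)
Definition Vh (R : realType) (N k : nat) : Type := 'I_N -> {poly_(k.+1) R}.

Definition ev (R : realType) (N k : nat) (v : Vh R N k) (j : 'I_N) (y : R) : R :=
  (v j : {poly R}).[y].

Definition ev_x (R : realType) (N k : nat) (v : Vh R N k) (j : 'I_N) (y : R) : R :=
  ((v j : {poly R})^`()).[y].

(* The interface x_{j+1/2} is indexed by the cell j on its left. ordS and
   ord_pred are the cyclic successor and predecessor: x_{N+1/2} and x_{1/2} are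
   the same interface. *)
Definition trm (R : realType) (N k : nat) (x : 'I_N.+1 -> R)
    (v : Vh R N k) (j : 'I_N) : R :=
  ev v j (xr x j).

Definition trp (R : realType) (N k : nat) (x : 'I_N.+1 -> R)
    (v : Vh R N k) (j : 'I_N) : R :=
  ev v (ordS j) (xl x (ordS j)).

Definition ip (R : realType) (N : nat) (x : 'I_N.+1 -> R) (j : 'I_N)
    (g h : R -> R) : R :=
  \int[lebesgue_measure]_(y in cell x j) (g y * h y).

(* A numerical flux is a function of the traces v^- and v^+, in this order. *)
Definition flux (R : realType) : Type := R -> R -> R.

Definition hat (R : realType) (N k : nat) (x : 'I_N.+1 -> R) (g : flux R)
    (v : Vh R N k) (j : 'I_N) : R :=
  g (trm x v j) (trp x v j).

Definition bdry (R : realType) (N k : nat) (x : 'I_N.+1 -> R) (j : 'I_N)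
    (vhat : 'I_N -> R) (phi : Vh R N k) : R :=
  vhat j * trm x phi j - vhat (ord_pred j) * trp x phi (ord_pred j).

Definition flux_minus (R : realType) : flux R := fun vm vp => vm.
Definition flux_plus (R : realType) : flux R := fun vm vp => vp.
Definition flux_avg (R : realType) : flux R := fun vm vp => (vm + vp) / 2.

(* f is continuous in every use, so the infimum and the supremum over the
   compact interval are the minimum and the maximum. *)
Definition flux_godunov (R : realType) (f : R -> R) : flux R := fun vm vp =>
  if vm < vp then inf (f @` `[vm, vp]%classic)
  else sup (f @` `[vp, vm]%classic).

Definition flux_conservative (R : realType) (f F : R -> R) : flux R :=
  fun vm vp =>
  if vp - vm != 0 then (F vp - F vm) / (vp - vm) else f (flux_avg vm vp).

Definition antiderivative (R : realType) (f F : R -> R) : Prop :=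
  forall y : R, is_derive y 1 F (f y).

(* Of the five unknowns only w_h is differentiated in time by the scheme, and
   only w_h is assumed differentiable. *)
Definition ldg_solution (R : realType) (N k : nat) (x : 'I_N.+1 -> R)
    (f : R -> R) (gf gu gr gs gp : flux R) (t0 t1 : R)
    (u r w ph s : R -> Vh R N k) : Prop :=
  forall t : R, t0 < t < t1 ->
  (forall (j : 'I_N) (y : R), cell x j y ->
     derivable (fun tau => ev (w tau) j y) t 1) /\
  forall (j : 'I_N) (phi psi vphi theta sigma : Vh R N k),
  [/\ ip x j (ev (u t) j) (ev phi j) - bdry x j (hat x gr (r t)) phi
        + ip x j (ev (r t) j) (ev_x phi j)
      = ip x j (ev (w t) j) (ev phi j),
      ip x j (ev (r t) j) (ev psi j) - bdry x j (hat x gu (u t)) psi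
        + ip x j (ev (u t) j) (ev_x psi j)
      = 0,
      ip x j (fun y => derive1 (fun tau => ev (w tau) j y) t) (ev vphi j)
        + ip x j (ev (s t) j) (ev vphi j)
      = bdry x j (hat x gp (ph t)) vphi - ip x j (ev (ph t) j) (ev_x vphi j),
      ip x j (ev (ph t) j) (ev theta j)
      = bdry x j (hat x gs (s t)) theta - ip x j (ev (s t) j) (ev_x theta j)
        - ip x j (ev (u t) j) (ev theta j)
    & ip x j (ev (s t) j) (ev sigma j)
      = bdry x j (hat x gf (u t)) sigma
        - ip x j (fun y => f (ev (u t) j y)) (ev_x sigma j)].

Definition scheme_D2 (R : realType) (N k : nat) (x : 'I_N.+1 -> R)
    (f : R -> R) (t0 t1 : R) (u r w ph s : R -> Vh R N k) : Prop :=
  ldg_solution x f (flux_godunov f)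
    (@flux_plus R) (@flux_minus R) (@flux_plus R) (@flux_minus R)
    t0 t1 u r w ph s.

Definition scheme_C2 (R : realType) (N k : nat) (x : 'I_N.+1 -> R)
    (f F : R -> R) (t0 t1 : R) (u r w ph s : R -> Vh R N k) : Prop :=
  ldg_solution x f (flux_conservative f F)
    (@flux_avg R) (@flux_avg R) (@flux_avg R) (@flux_avg R)
    t0 t1 u r w ph s.

(* Integrals over I of piecewise polynomials, cell by cell. E1 is applied to
   w_h and E2 to u_h. *)
Definition E1 (R : realType) (N k : nat) (x : 'I_N.+1 -> R) (w : Vh R N k) : R :=
  \sum_(j < N) \int[lebesgue_measure]_(y in cell x j) ev w j y.

Definition E2 (R : realType) (N k : nat) (x : 'I_N.+1 -> R) (u : Vh R N k) : R :=
  \sum_(j < N) \int[lebesgue_measure]_(y in cell x j) (ev u j y ^+ 2).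

(* Main.v *)
Require Import Defs.
From HB Require Import structures.
From mathcomp Require Import all_boot all_order all_algebra.
From mathcomp Require Import all_classical all_reals all_analysis.
From mathcomp Require Import ring lra.

Set Implicit Arguments.
Unset Strict Implicit.
Unset Printing Implicit Defensive.

Import Order.TTheory GRing.Theory Num.Theory.
Import numFieldNormedType.Exports.
Local Open Scope classical_set_scope.
Local Open Scope ring_scope.

(** Write ( , ) for the L2 product on the broken polynomial space and, for a
numerical flux g, let b_g(v, phi) be the sum over the cells of
<g(v), phi> - (v, phi_x), the weak form of a discrete derivative D_g.  The
linear part of either scheme uses one flux g for r and p and one flux g' for
u and s.  Summation by parts around the periodic mesh gives
b_g(v, phi) = - b_g'(phi, v), and b_g(v, v) is half the sum of the squared
jumps of v for the alternating fluxes and 0 for the central ones.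

Conservation of E1: testing the third and fifth equations with the constant 1
leaves only flux differences, whose sum telescopes around the periodic mesh.

Energy.  Put A = 1 - D_g D_g'.  The first two equations say A u = w.  Since
D_g' is minus the adjoint of D_g, A is the identity plus a positive operator;
in weak form, the mixed problem v - D_g q = h, q = D_g' v has the coercive form
(v, v) + (q, q) on the product space, so it is uniquely solvable
(helmholtz_solver).  The scheme differentiates only w in time, but u = A^-1 w
is a fixed linear image of w, hence differentiable.

Eliminating p from the last three equations gives A (u_t + s) = - D_g u.  Let
v = A^-1 u and q = D_g' v.  The duality of the two forms then yields
(energy_identity)
  (u_t, u) = - (s, u) - b_g(v, v) - b_g(q, q).
The last two terms have a sign, or vanish.  For the first, the chain rule on
each cell turns (s, u) into the sum over the interfaces of
F(u^+) - F(u^-) - fhat (u^+ - u^-) (nonlinear_flux_energy).  By the mean value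
theorem the difference F(u^+) - F(u^-) is f(c) (u^+ - u^-) with c between the
traces, so the Godunov flux, which takes the extreme value of f on the correct
side, makes each term nonnegative; the conservative flux is defined to make
each term zero. *)

(** * Bilinear forms in finite dimension *)

Section ScalarForms.
Variables (K : fieldType) (V : vectType K).

Definition bilinear_form (W : lmodType K) (B : W -> W -> K) : Prop :=
  (forall w, scalar (B^~ w)) /\ (forall v, scalar (B v)).

Section Scalar.
Variables (W : lmodType K) (l : W -> K) (ll : scalar l).

Lemma scalar0 : l 0 = 0.
Proof. by have := ll (-1) 0 0; rewrite scaler0 addr0 mulN1r addNr. Qed.

Lemma scalarD u v : l (u + v) = l u + l v.
Proof. by have := ll 1 u v; rewrite scale1r mul1r. Qed.

Lemma scalarZ a v : l (a *: v) = a * l v.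
Proof. by have := ll a v 0; rewrite addr0 scalar0 addr0. Qed.

Lemma scalar_sum (I : finType) (c : I -> K) (e : I -> W) :
  l (\sum_i c i *: e i) = \sum_i c i * l (e i).
Proof.
rewrite (big_morph l scalarD scalar0).
by apply: eq_bigr => i _; rewrite scalarZ.
Qed.

End Scalar.

Lemma vbasis_sum (v : V) :
  v = \sum_(i < \dim {:V}) coord (vbasis fullv) i v *: (vbasis fullv)`_i.
Proof. by rewrite -coord_vbasis ?memvf. Qed.

(** Only injectivity of v |-> B v is at stake, and definiteness gives it.  The
dual space is modelled on V itself: the functional B v is recorded by the
vector whose coordinates are its values on a basis. *)
Lemma lax_milgram (B : V -> V -> K) (l : V -> K) :
  bilinear_form B -> (forall v, B v v = 0 -> v = 0) -> scalar l ->
  exists v, forall w, B v w = l w.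
Proof.
move=> [Bl Br] Bdef ll.
pose X := vbasis (fullv : {vspace V}); pose e i := X`_i.
pose gram (v : V) : V := \sum_(i < \dim {:V}) B v (e i) *: e i.
have gram_lin : linear gram.
  move=> a u v; rewrite /gram scaler_sumr -big_split /=.
  by apply: eq_bigr => i _; rewrite Bl scalerDl scalerA.
pose gramL : {linear V -> V} :=
  HB.pack gram (GRing.isLinear.Build K V V *:%R gram gram_lin).
pose T := linfun gramL.
have TE v : T v = gram v by rewrite lfunE.
have Xfree : free X by apply: (basis_free (vbasisP fullv)).
have coordE c i : coord X i (\sum_(j < \dim {:V}) c j *: e j) = c i.
  by rewrite coord_sum_free.
have kerT : lker T == 0%VS.
  rewrite -subv0; apply/subvP => v; rewrite memv_ker memv0 => /eqP Tv0.
  apply/eqP/Bdef; rewrite {2}(vbasis_sum v) (scalar_sum (Br v)).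
  apply: big1 => i _.
  have := coordE (fun j => B v (e j)) i.
  by rewrite -/(gram v) -TE Tv0 linear0 /e => <-; rewrite mulr0.
exists (T^-1%VF (\sum_(i < \dim {:V}) l (e i) *: e i)) => w.
set v := T^-1%VF _.
have Bve (i : 'I_(\dim {:V})) : B v (e i) = l (e i).
  have := coordE (fun j => B v (e j)) i.
  by rewrite -/(gram v) -TE /v (lker0_lfunVK kerT) coordE.
rewrite (vbasis_sum w) (scalar_sum (Br v)) (scalar_sum ll).
by apply: eq_bigr => i _; congr (_ * _); exact: Bve.
Qed.

End ScalarForms.

(** * The mixed elliptic problem and the energy identity *)

Section EllipticSystem.
Variables (R : realType) (V : vectType R) (G bm bp : V -> V -> R).
Hypotheses (G_bil : bilinear_form G) (bm_bil : bilinear_form bm).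
Hypotheses (bp_bil : bilinear_form bp).
Hypothesis G_sym : forall u v, G u v = G v u.
Hypothesis G_ge0 : forall v, 0 <= G v v.
Hypothesis G_def : forall v, G v v = 0 -> v = 0.
Hypothesis bm_dual : forall u v, bm u v = - bp v u.

(** The weak form of v - v_xx = g, written as the first-order system
v - q_x = g, q = v_x, where G is the L2 product and bm, bp are the weak
derivatives of q and of v. *)
Definition helmholtz (g v q : V) : Prop :=
  (forall phi, G v phi - bm q phi = G g phi) /\
  (forall psi, G q psi = bp v psi).

(** Testing with (v, q) itself, the two derivative terms cancel by duality and
G v v + G q q = 0 is left. *)
Lemma helmholtz_homogeneous v q : helmholtz 0 v q -> v = 0 /\ q = 0.
Proof.
move=> [ev eq]; have := ev v; have := eq q.
rewrite (scalar0 (G_bil.1 v)) (bm_dual q v) => Gqq Gvv.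
have Gv := G_ge0 v; have Gq := G_ge0 q.
by split; apply: G_def; lra.
Qed.

Lemma helmholtz_linear a g1 v1 q1 g2 v2 q2 :
  helmholtz g1 v1 q1 -> helmholtz g2 v2 q2 ->
  helmholtz (a *: g1 + g2) (a *: v1 + v2) (a *: q1 + q2).
Proof.
move=> [ev1 eq1] [ev2 eq2]; split=> phi.
  by rewrite !(G_bil.1 phi) (bm_bil.1 phi) -ev1 -ev2; ring.
by rewrite (G_bil.1 phi) (bp_bil.1 phi) eq1 eq2.
Qed.

Lemma helmholtz_unique g v q v' q' :
  helmholtz g v q -> helmholtz g v' q' -> v = v' /\ q = q'.
Proof.
move=> h h'; have := helmholtz_linear (-1) h' h.
rewrite !scaleN1r addNr => /helmholtz_homogeneous[].
by rewrite ![- _ + _]addrC => /subr0_eq-> /subr0_eq->.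
Qed.

(** The same cancellation makes the form of the system definite on V * V. *)
Lemma helmholtz_exists g : exists vq : V * V, helmholtz g vq.1 vq.2.
Proof.
pose B (z w : V * V) := G z.1 w.1 - bm z.2 w.1 + (G z.2 w.2 - bp z.1 w.2).
have B_bil : bilinear_form B.
  split=> [w a z z'|z a w w']; rewrite /B /=.
    by rewrite !(G_bil.1 _) (bm_bil.1 _) (bp_bil.1 _); ring.
  by rewrite !(G_bil.2 _) (bm_bil.2 _) (bp_bil.2 _); ring.
have B_def z : B z z = 0 -> z = 0.
  case: z => v q; rewrite /B /= bm_dual => Bz.
  have := G_ge0 v; have := G_ge0 q => Gq Gv.
  have v0 : v = 0 by apply: G_def; lra.
  have q0 : q = 0 by apply: G_def; lra.
  by rewrite v0 q0.
have l_lin : scalar (fun w : V * V => G g w.1).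
  by move=> a w w'; rewrite /= (G_bil.2 _).
have [vq Bvq] := lax_milgram B_bil B_def l_lin.
exists vq; split=> phi.
  have := Bvq (phi, 0); rewrite /B /= (scalar0 (G_bil.2 _)).
  by rewrite (scalar0 (bp_bil.2 _)) subr0 addr0.
have := Bvq (0, phi); rewrite /B /= !(scalar0 (G_bil.2 _)).
by rewrite (scalar0 (bm_bil.2 _)) subr0 add0r => /subr0_eq.
Qed.

Lemma helmholtz_solver : exists S T : V -> V,
  (forall g, helmholtz g (S g) (T g)) /\ linear S.
Proof.
have [ST hST] := choice helmholtz_exists.
exists (fun g => (ST g).1), (fun g => (ST g).2); split=> // a g g'.
by have [] := helmholtz_unique (hST (a *: g + g'))
  (helmholtz_linear a (hST g) (hST g')).
Qed.

(** In operator form the hypotheses read A u' = w', w' + s = Dm p and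
p = Dp s - u.  So y = u' + s and z = r' + p = Dp y - u satisfy y = Dm z.
Replacing u by v - Dm q and moving derivatives across with bm_dual, the terms
in z cancel. *)
Lemma energy_identity u s p w' u' r' :
  helmholtz w' u' r' ->
  (forall phi, G w' phi + G s phi = bm p phi) ->
  (forall theta, G p theta = bp s theta - G u theta) ->
  exists v q, G u' u = - G s u - bm v v - bm q q.
Proof.
move=> [hu' hr'] hw hp; have [[v q] /= [hv hq]] := helmholtz_exists u.
exists v, q; pose y := u' + s; pose z := r' + p.
have yE phi : G y phi = bm z phi.
  rewrite (scalarD (G_bil.1 phi)) (scalarD (bm_bil.1 phi)) -hw -hu'; ring.
have zE th : G z th = bp y th - G u th.
  by rewrite (scalarD (G_bil.1 th)) (scalarD (bp_bil.1 th)) hp hr'; ring.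
(* (y, u) = (v, y) - bm q y = bm z v + bp y q = - (q, z) + (z, q) + (u, q),
   and (u, q) = (v, q) - bm q q = bp v v - bm q q. *)
have Gyu : G y u = - bm v v - bm q q.
  rewrite G_sym -hv (bm_dual q) G_sym yE (bm_dual z) -hq G_sym zE -hv G_sym hq.
  rewrite (bm_dual v v); ring.
by have := Gyu; rewrite (scalarD (G_bil.1 u)) => Gu; lra.
Qed.

End EllipticSystem.

(** * Time derivatives of vector-valued functions *)

Section WeakDerivative.
Variables (R : realType) (V : vectType R).

(** Differentiability tested on linear functionals: in finite dimension this is
differentiability, and it passes through linear maps by composing
functionals. *)
Definition is_weak_derive (v : R -> V) (t : R) (v' : V) : Prop :=
  forall l : V -> R, scalar l -> is_derive t 1 (fun tau => l (v tau)) (l v').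

Lemma is_derive_finsum (I : finType) (h : I -> R -> R) (t : R) (dh : I -> R) :
  (forall i, is_derive t 1 (h i) (dh i)) ->
  is_derive t 1 (fun tau => \sum_i h i tau) (\sum_i dh i).
Proof.
move=> hd; rewrite [X in is_derive _ _ X _](_ : _ = \sum_i h i).
  by elim/big_ind2 : _ => // [|] *; [exact: is_derive_cst|exact: is_deriveD].
by apply/funext => tau; rewrite fct_sumE.
Qed.

Lemma is_weak_derive_linear (S : V -> V) (v w : R -> V) t w' :
  linear S -> is_weak_derive w t w' -> (\near t, v t = S (w t)) ->
  is_weak_derive v t (S w').
Proof.
move=> Sl hw vS l ll.
have lSl : scalar (fun z => l (S z)) by move=> a x y /=; rewrite Sl ll.
apply: near_eq_is_derive (hw _ lSl).
by near=> tau; congr l; apply/esym; near: tau.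
Unshelve. all: by end_near. Qed.

(** Expanding the left argument in a basis writes G (v t) (v t) as a finite sum
of products of two linear functionals of v t. *)
Lemma is_weak_derive_quadratic (G : V -> V -> R) (v : R -> V) t v' :
  bilinear_form G -> (forall x y, G x y = G y x) -> is_weak_derive v t v' ->
  is_derive t 1 (fun tau => G (v tau) (v tau)) (2 * G v' (v t)).
Proof.
move=> [Gl Gr] Gs hv; pose X := vbasis (fullv : {vspace V}).
have GE x y : G x y = \sum_(i < \dim {:V}) coord X i x * G X`_i y.
  by rewrite {1}(vbasis_sum x) (scalar_sum (Gl y)).
rewrite [X in is_derive _ _ X _](_ : _ =
    fun tau => \sum_(i < \dim {:V}) coord X i (v tau) * G X`_i (v tau)).
  apply: is_derive_eq.
    apply: is_derive_finsum => i; apply: is_deriveM; apply: hv => //.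
    by move=> a x y; rewrite linearP.
  rewrite big_split /= mulr_natl mulr2n; congr (_ + _).
    rewrite [in RHS]Gs (GE (v t)).
    by apply: eq_bigr => i _; rewrite Gs.
  by rewrite GE; apply: eq_bigr => i _; rewrite mulrC.
by apply/funext => tau; rewrite GE.
Qed.

End WeakDerivative.

(** * Integrals of polynomials over a segment *)

Lemma integral_derivative (R : realType) (a b : R) (g h : R -> R) : a < b ->
  continuous g -> (forall y : R, is_derive y 1 h (g y)) ->
  \int[lebesgue_measure]_(y in `[a, b]%classic) g y = h b - h a.
Proof.
move=> ab cg hg.
have ch : continuous h.
  by move=> y; apply/differentiable_continuous/derivable1_diffP; case: (hg y).
rewrite /Rintegral (continuous_FTC2 (F := h) ab) //.
- exact: continuous_subspaceT.
- split; first by move=> y _; case: (hg y).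
  + by apply: cvg_at_right_filter; exact: ch.
  + by apply: cvg_at_left_filter; exact: ch.
- by move=> y _; rewrite derive1E; case: (hg y).
Qed.

(** Infinitely many distinct points of the segment, on which polynomials of any
degree can be tested or interpolated. *)
Definition node (R : realType) (a b : R) (i : nat) : R := a + (b - a) / i.+1%:R.

Lemma node_segment (R : realType) (a b : R) i : a < b -> a <= node a b i <= b.
Proof.
move=> ab; have ba : 0 <= b - a by rewrite subr_ge0 ltW.
rewrite /node lerDl divr_ge0 ?ler0n //= -lerBrDl.
by rewrite ler_pdivrMr ?ltr0n // ler_peMr // ler1n.
Qed.

Lemma node_inj (R : realType) (a b : R) : a < b -> injective (node a b).
Proof.
move=> ab i j /addrI/mulfI E; have /E/invr_inj/eqP : b - a != 0.
  by rewrite subr_eq0 gt_eqF.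
by rewrite eqr_nat => /eqP[].
Qed.

Lemma poly_eq0_segment (R : realType) (a b : R) (P : {poly R}) : a < b ->
  (forall y, a <= y <= b -> P.[y] = 0) -> P = 0.
Proof.
move=> ab P0; apply/eqP/negPn/negP => Pn0.
pose rs := [seq node a b i | i <- iota 0 (size P)].
have rs_roots : all (root P) rs.
  by apply/allP => _ /mapP[i _ ->]; rewrite rootE P0 // node_segment.
have rs_uniq : uniq rs by rewrite map_inj_uniq ?iota_uniq //; exact: node_inj.
by have := max_poly_roots Pn0 rs_roots rs_uniq; rewrite size_map size_iota ltnn.
Qed.

Section PolynomialIntegral.
Variables (R : realType) (a b : R).
Hypothesis ab : a < b.
Implicit Types (P Q : {poly R}).

Definition polyint P : R :=
  \int[lebesgue_measure]_(y in `[a, b]%classic) P.[y].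

Lemma polyint_deriv Q : polyint Q^`() = Q.[b] - Q.[a].
Proof. by apply: integral_derivative => //; exact: continuous_horner. Qed.

Lemma poly_antiderivative P : exists Q, Q^`() = P.
Proof.
exists (\poly_(i < (size P).+1) (P`_i.-1 / i%:R)); apply/polyP => i.
rewrite coef_deriv coef_poly ltnS /=.
have [_|/(nth_default 0)->] := ltnP; last by rewrite mul0rn.
by rewrite -[LHS]mulr_natr divfK // pnatr_eq0.
Qed.

(** The integral is the increment of an antiderivative, and antiderivatives
depend linearly on the integrand. *)
Lemma polyint_scalar : scalar polyint.
Proof.
move=> c P1 P2; have [Q1 <-] := poly_antiderivative P1.
have [Q2 <-] := poly_antiderivative P2.
by rewrite -derivZ -derivD !polyint_deriv !hornerE /=; ring.
Qed.

Lemma polyint_linl c P1 P2 Q :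
  polyint ((c *: P1 + P2) * Q) = c * polyint (P1 * Q) + polyint (P2 * Q).
Proof. by rewrite mulrDl -scalerAl polyint_scalar. Qed.

Lemma polyint_linr c P Q1 Q2 :
  polyint (P * (c *: Q1 + Q2)) = c * polyint (P * Q1) + polyint (P * Q2).
Proof. by rewrite mulrDr -scalerAr polyint_scalar. Qed.

Lemma polyint_sqr_ge0 P : 0 <= polyint (P * P).
Proof.
apply: Rintegral_ge0 => y _.
by rewrite hornerM -expr2 sqr_ge0.
Qed.

(** An antiderivative Q of P * P is nondecreasing with equal endpoint values,
so it is constant on the segment, hence constant as a polynomial. *)
Lemma polyint_sqr_eq0 P : polyint (P * P) = 0 -> P = 0.
Proof.
have [Q QP] := poly_antiderivative (P * P).
rewrite -QP polyint_deriv => /subr0_eq Qba.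
have Qmono y z : y <= z -> Q.[y] <= Q.[z].
  move=> yz.
  have [|c _ /eqP] := @MVT_segment R (horner Q) (horner Q^`()) y z yz.
    by apply: continuous_subspaceT; exact: continuous_horner.
  rewrite subr_eq QP hornerM => /eqP->.
  by rewrite lerDr mulr_ge0 ?subr_ge0 // -expr2 sqr_ge0.
apply/eqP; rewrite -[P == 0]orbb -mulf_eq0 -QP.
have -> : Q = (Q.[a])%:P; last by rewrite derivC.
apply/subr0_eq/(poly_eq0_segment ab) => y /andP[ay yb].
rewrite !hornerE; apply/eqP; rewrite subr_eq0 eq_le.
by rewrite -{1}Qba !Qmono.
Qed.

End PolynomialIntegral.

(** * Interface contributions of the nonlinear fluxes *)

(** The mean value theorem writes F vp - F vm as f c * (vp - vm) with c between
the traces, and the flux bounds f c from below or above according to the sign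
of vp - vm. *)
Lemma godunov_dissipative (R : realType) (f F : R -> R) (vm vp : R) :
  continuous f -> antiderivative f F ->
  0 <= F vp - F vm - flux_godunov f vm vp * (vp - vm).
Proof.
move=> cf hF.
have cF : continuous F.
  by move=> y; apply/differentiable_continuous/derivable1_diffP; case: (hF y).
have mvt y z : y <= z ->
    exists2 c, c \in `[y, z]%R & F z - F y = f c * (z - y).
  move=> yz; apply: (@MVT_segment R F f y z yz); first by move=> c _; exact: hF.
  exact: continuous_subspaceT.
rewrite /flux_godunov; case: ltP => [lt|le].
  have [c cI ->] := mvt _ _ (ltW lt).
  rewrite -mulrBl mulr_ge0 ?subr_ge0 ?(ltW lt) //.
  apply: ge_inf; last by exists c.
  have [m _ hm] := EVT_min (ltW lt) (continuous_subspaceT cf).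
  by exists (f m) => _ [y yI <-]; exact: hm.
have [c cI E] := mvt _ _ le.
set s := sup _; have fs : f c <= s.
  apply: ub_le_sup; last by exists c.
  have [m _ hm] := EVT_max le (continuous_subspaceT cf).
  by exists (f m) => _ [y yI <-]; exact: hm.
rewrite -(opprB vm vp) -(opprB (F vm)) E mulrN opprK addrC -mulrBl.
by rewrite mulr_ge0 ?subr_ge0.
Qed.

Lemma conservative_neutral (R : realType) (f F : R -> R) (vm vp : R) :
  F vp - F vm - flux_conservative f F vm vp * (vp - vm) = 0.
Proof.
rewrite /flux_conservative; case: ifPn => [ne|]; first by rewrite divfK ?subrr.
by rewrite negbK subr_eq0 => /eqP ->; rewrite !subrr mulr0 subr0.
Qed.

(** * Weak derivatives on the broken polynomial space *)

Section LDG.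
Variables (R : realType) (N k : nat) (x : 'I_N.+1 -> R).
Hypothesis xlr : forall j, xl x j < xr x j.

Notation Vh := (Vh R N k).
Notation Space := {ffun 'I_N -> {poly_(k.+1) R}}.

(** Vh is a bare function type; finite functions give the same elements with
the vector space structure that linear algebra needs. *)
Definition toVh (v : Space) : Vh := fun j => v j.
Definition ofVh (v : Vh) : Space := [ffun j => v j].

Lemma ofVhK v : toVh (ofVh v) = v.
Proof. by apply/funext => j; rewrite /toVh ffunE. Qed.

Definition l2 (u v : Vh) : R := \sum_(j < N) ip x j (ev u j) (ev v j).

(** The weak form of the discrete derivative with numerical flux g. *)
Definition weak_dx (g : flux R) (v phi : Vh) : R :=
  \sum_(j < N) (bdry x j (hat x g v) phi - ip x j (ev v j) (ev_x phi j)).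

Lemma ip_polyint j (P Q : {poly R}) :
  ip x j (horner P) (horner Q) = polyint (xl x j) (xr x j) (P * Q).
Proof. by apply: eq_Rintegral => y _; rewrite hornerM. Qed.

Lemma toVh_lin c u v j :
  (toVh (c *: u + v) j : {poly R}) = c *: (toVh u j : {poly R}) + toVh v j.
Proof. by rewrite /toVh !ffunE. Qed.

Lemma ev_lin c u v j y :
  ev (toVh (c *: u + v)) j y = c * ev (toVh u) j y + ev (toVh v) j y.
Proof. by rewrite /ev toVh_lin !hornerE. Qed.

Lemma l2_bilinear : bilinear_form (fun u v : Space => l2 (toVh u) (toVh v)).
Proof.
split=> [w c u v|w c u v]; rewrite /l2 /= mulr_sumr -big_split /=;
  apply: eq_bigr => j _; rewrite !ip_polyint toVh_lin.
  by rewrite (polyint_linl (xlr j)).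
by rewrite (polyint_linr (xlr j)).
Qed.

Lemma l2_sym u v : l2 u v = l2 v u.
Proof. by apply: eq_bigr => j _; rewrite !ip_polyint mulrC. Qed.

Lemma l2_ge0 v : 0 <= l2 v v.
Proof.
by apply: sumr_ge0 => j _; rewrite ip_polyint; exact: polyint_sqr_ge0.
Qed.

Lemma l2_definite (v : Space) : l2 (toVh v) (toVh v) = 0 -> v = 0.
Proof.
move=> /eqP; rewrite psumr_eq0 => [/allP v0|j _]; last first.
  by rewrite ip_polyint; exact: polyint_sqr_ge0.
apply/ffunP => j; rewrite ffunE; apply/val_inj.
have /eqP := v0 j (mem_index_enum _); rewrite ip_polyint.
exact: polyint_sqr_eq0.
Qed.

Definition linear_flux (g : flux R) : Prop :=
  forall c um up vm vp, g (c * um + vm) (c * up + vp) = c * g um up + g vm vp.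

Lemma weak_dx_bilinear g : linear_flux g ->
  bilinear_form (fun u v : Space => weak_dx g (toVh u) (toVh v)).
Proof.
move=> gl; split=> [w c u v|w c u v]; rewrite /weak_dx /= mulr_sumr -big_split;
  apply: eq_bigr => j _;
  rewrite /= /bdry /hat /trm /trp !ip_polyint !ev_lin ?gl.
  by rewrite toVh_lin (polyint_linl (xlr j)); ring.
by rewrite toVh_lin derivD derivZ (polyint_linr (xlr j)); ring.
Qed.

Lemma sum_ord_pred (h : 'I_N -> R) :
  \sum_(j < N) h (ord_pred j) = \sum_(j < N) h j.
Proof. by rewrite [RHS](reindex_inj (@ord_pred_inj N)). Qed.

Lemma trp_pred (v : Vh) j : trp x v (ord_pred j) = ev v j (xl x j).
Proof. by rewrite /trp ord_predK. Qed.

Lemma sum_bdry (h : 'I_N -> R) (phi : Vh) :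
  \sum_(j < N) bdry x j h phi = \sum_(j < N) h j * (trm x phi j - trp x phi j).
Proof.
rewrite /bdry sumrB (sum_ord_pred (fun j => h j * trp x phi j)) -sumrB.
by apply: eq_bigr => j _; rewrite mulrBr.
Qed.

Lemma weak_dxE g (v phi : Vh) :
  weak_dx g v phi =
  \sum_(j < N) hat x g v j * (trm x phi j - trp x phi j)
  - \sum_(j < N) ip x j (ev v j) (ev_x phi j).
Proof. by rewrite /weak_dx sumrB sum_bdry. Qed.

(** The volume terms add up to the integral of (v phi)_x on each cell, so only
interface terms remain; the periodic shift moves the contributions at left
endpoints to the interface indexed by the preceding cell. *)
Lemma weak_dx_by_parts g g' (v phi : Vh) :
  weak_dx g v phi + weak_dx g' phi v =
  \sum_(j < N) (hat x g v j * (trm x phi j - trp x phi j)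
    + hat x g' phi j * (trm x v j - trp x v j)
    - (trm x v j * trm x phi j - trp x v j * trp x phi j)).
Proof.
rewrite !weak_dxE sumrB big_split /= addrACA -opprD.
congr (_ - _); rewrite sumrB.
rewrite -[X in _ - X](sum_ord_pred (fun j => trp x v j * trp x phi j)) -sumrB.
rewrite -big_split; apply: eq_bigr => j _; rewrite /= !trp_pred !ip_polyint.
rewrite -(scalarD (polyint_scalar (xlr j))).
rewrite addrC [X in polyint _ _ (X + _)]mulrC -derivM.
by rewrite polyint_deriv // !hornerM.
Qed.

Lemma weak_dx_dual_alternating (v phi : Vh) :
  weak_dx (@flux_minus R) v phi = - weak_dx (@flux_plus R) phi v.
Proof.
apply/eqP; rewrite -addr_eq0 weak_dx_by_parts; apply/eqP/big1 => j _.
by rewrite /hat /flux_minus /flux_plus; ring.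
Qed.

Lemma weak_dx_dual_central (v phi : Vh) :
  weak_dx (@flux_avg R) v phi = - weak_dx (@flux_avg R) phi v.
Proof.
apply/eqP; rewrite -addr_eq0 weak_dx_by_parts; apply/eqP/big1 => j _.
by rewrite /hat /flux_avg; field.
Qed.

(** The form is half the sum of the squared jumps of v. *)
Lemma weak_dx_upwind_ge0 (v : Vh) : 0 <= weak_dx (@flux_minus R) v v.
Proof.
rewrite -(pmulrn_lge0 _ (ltn0Sn 1)) mulr2n weak_dx_by_parts.
apply: sumr_ge0 => j _; rewrite /hat /flux_minus.
rewrite [leRHS](_ : _ = (trm x v j - trp x v j) ^+ 2) ?sqr_ge0 //; ring.
Qed.

Lemma weak_dx_central_eq0 (v : Vh) : weak_dx (@flux_avg R) v v = 0.
Proof. by have := weak_dx_dual_central v v; lra. Qed.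

Lemma ip_flux_chain (f F : R -> R) (v : Vh) j :
  continuous f -> antiderivative f F ->
  ip x j (fun y => f (ev v j y)) (ev_x v j) =
  F (trm x v j) - F (ev v j (xl x j)).
Proof.
move=> cf hF.
apply: (@integral_derivative R _ _ _ (F \o horner (v j))) => //.
  move=> y; apply: continuousM; last exact: continuous_horner.
  by apply: continuous_comp; [exact: continuous_horner|exact: cf].
by move=> y; apply: is_derive1_comp.
Qed.

(** f(u) u_x integrates to F(u) on each cell, so pairing s with u leaves one
term per interface, the same one that the flux inequalities control. *)
Lemma nonlinear_flux_energy (f F : R -> R) (gf : flux R) (u s : Vh) :
  continuous f -> antiderivative f F ->
  (forall j, ip x j (ev s j) (ev u j) =
     bdry x j (hat x gf u) u - ip x j (fun y => f (ev u j y)) (ev_x u j)) ->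
  l2 s u = \sum_(j < N) (F (trp x u j) - F (trm x u j)
             - hat x gf u j * (trp x u j - trm x u j)).
Proof.
move=> cf hF hs; rewrite /l2 (eq_bigr _ (fun j _ => hs j)) sumrB sum_bdry.
under [X in _ - X]eq_bigr => j _ do rewrite (ip_flux_chain _ _ cf hF) -trp_pred.
rewrite sumrB (sum_ord_pred (fun j => F (trp x u j))) -!sumrB.
by apply: eq_bigr => j _; ring.
Qed.

Definition oneVh : Vh := fun=> npolyp k.+1 1.

Lemma ev_one j y : ev oneVh j y = 1.
Proof. by rewrite /ev /= npolypK ?size_poly1 // hornerC. Qed.

Lemma ev_x_one j y : ev_x oneVh j y = 0.
Proof. by rewrite /ev_x /= npolypK ?size_poly1 // derivC horner0. Qed.

Lemma sum_bdry_one (h : 'I_N -> R) : \sum_(j < N) bdry x j h oneVh = 0.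
Proof.
by rewrite sum_bdry big1 // => j _; rewrite /trm /trp !ev_one subrr mulr0.
Qed.

Lemma ip_dx_one (h : R -> R) j : ip x j h (ev_x oneVh j) = 0.
Proof.
rewrite /ip; under eq_Rintegral do rewrite ev_x_one mulr0.
by rewrite /Rintegral integral0.
Qed.

Lemma E1_l2 (w : Vh) : E1 x w = l2 w oneVh.
Proof.
by apply: eq_bigr => j _; apply: eq_Rintegral => y _; rewrite ev_one mulr1.
Qed.

Lemma E2_l2 (u : Vh) : E2 x u = l2 u u.
Proof.
by apply: eq_bigr => j _; apply: eq_Rintegral => y _; rewrite expr2.
Qed.

(** On each cell a polynomial of degree at most k is a fixed linear combination
of its values at k + 1 points of that cell, and these values are
differentiable by hypothesis.  In particular the pointwise time derivative is
again an element of the broken polynomial space, so it may be used in the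
weak forms. *)
Lemma is_weak_derive_pointwise (w : R -> Vh) (t : R) :
  (forall (j : 'I_N) y, cell x j y ->
     derivable (fun tau => ev (w tau) j y) t 1) ->
  exists w' : Space, is_weak_derive (fun tau => ofVh (w tau)) t w' /\
    forall (j : 'I_N) y, cell x j y ->
      derive1 (fun tau => ev (w tau) j y) t = ev (toVh w') j y.
Proof.
move=> hd; pose pt (j : 'I_N) := node (xl x j) (xr x j).
pose c (i : 'I_N * 'I_k.+1) tau := ev (w tau) i.1 (pt i.1 i.2).
pose e (i : 'I_N * 'I_k.+1) : Space :=
  [ffun j => if j == i.1 then tnth (lagrange k.+1 (pt j)) i.2 else 0].
have wE tau : ofVh (w tau) = \sum_i c i tau *: e i.
  apply/ffunP => j; rewrite sum_ffunE ffunE.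
  rewrite -(pair_bigA _ (fun j' i => (c (j', i) tau *: e (j', i)) j)) /=.
  rewrite (bigD1 j) //= [X in _ + X]big1 ?addr0 => [|j' j'j]; last first.
    by apply: big1 => i _; rewrite !ffunE /= eq_sym (negPf j'j) scaler0.
  apply/val_inj; rewrite /= raddf_sum /=.
  rewrite {1}(@lagrange_gen R k.+1 (pt j) isT (node_inj (xlr j)) _
    (size_npoly (w tau j))).
  by apply: eq_bigr => i _; rewrite !ffunE /= eqxx mul_polyC.
have cD i : derivable (c i) t 1.
  by apply: hd; rewrite /cell /= in_itv /=; exact: node_segment.
exists (\sum_i 'D_1 (c i) t *: e i).
have wD : is_weak_derive (fun tau => ofVh (w tau)) t
    (\sum_i 'D_1 (c i) t *: e i).
  move=> l ll; rewrite (scalar_sum ll).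
  rewrite [X in is_derive _ _ X _](_ : _ = fun tau => \sum_i c i tau * l (e i)).
    apply: is_derive_finsum => i; apply: is_derive_eq.
      by apply: is_deriveM; exact: derivableP.
    by rewrite scaler0 add0r mulrC.
  by apply/funext => tau; rewrite wE (scalar_sum ll).
split=> // j y _.
have ev_scalar : scalar (fun v : Space => ev (toVh v) j y).
  by move=> a u v; rewrite ev_lin.
rewrite derive1E -[RHS](@derive_val _ _ _ _ _ _ _ (wD _ ev_scalar)).
by congr ('D_1 _ t); apply/funext => tau; rewrite /= ofVhK.
Qed.

End LDG.

Lemma mesh_cell (R : realType) (a b : R) (N : nat) (x : 'I_N.+1 -> R) j :
  is_mesh a b x -> xl x j < xr x j.
Proof. by move=> [_ _ hx]; apply: hx; rewrite lift0. Qed.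

(** * Rates of change for the semi-discrete scheme *)

Section EnergyRate.
Variables (R : realType) (N k : nat) (x : 'I_N.+1 -> R).
Hypothesis xlr : forall j, xl x j < xr x j.
Variables (f F : R -> R) (gf gm gq : flux R).
Hypotheses (cf : continuous f) (hF : antiderivative f F).
Hypotheses (gm_lin : linear_flux gm) (gq_lin : linear_flux gq).
Hypothesis weak_dual : forall v phi : Vh R N k,
  weak_dx x gm v phi = - weak_dx x gq phi v.
Variables (t0 t1 : R) (u r w ph s : R -> Vh R N k).
Hypothesis sol : ldg_solution x f gf gq gm gq gm t0 t1 u r w ph s.

Notation Space := {ffun 'I_N -> {poly_(k.+1) R}}.

Let G (v z : Space) := l2 x (toVh v) (toVh z).
Let bm (v z : Space) := weak_dx x gm (toVh v) (toVh z).
Let bq (v z : Space) := weak_dx x gq (toVh v) (toVh z).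

Lemma scheme_helmholtz tau : t0 < tau < t1 ->
  helmholtz G bm bq (ofVh (w tau)) (ofVh (u tau)) (ofVh (r tau)).
Proof.
move=> /sol[_ hs]; split=> z; rewrite /G /bm /bq !ofVhK.
  rewrite /l2 /weak_dx -sumrB; apply: eq_bigr => j _.
  have [<- _ _ _ _] := hs j (toVh z) (toVh z) (toVh z) (toVh z) (toVh z).
  by ring.
rewrite /l2 /weak_dx; apply: eq_bigr => j _.
by have [_ + _ _ _] := hs j (toVh z) (toVh z) (toVh z) (toVh z) (toVh z); lra.
Qed.

(** The alternating and the central scheme at once, for an arbitrary numerical
flux gf of f: the choice of gm and gq enters through weak_dual, and (v, q) is
the solution of the elliptic problem with right-hand side u. *)
Lemma ldg_rates t : t0 < t < t1 ->
  is_derive t 1 (fun tau => E1 x (w tau)) 0 /\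
  exists v q : Vh R N k, is_derive t 1 (fun tau => E2 x (u tau))
    (2 * (- (\sum_(j < N) (F (trp x (u t) j) - F (trm x (u t) j)
               - hat x gf (u t) j * (trp x (u t) j - trm x (u t) j)))
          - weak_dx x gm v v - weak_dx x gm q q)).
Proof.
move=> ht; have [hd hs] := sol ht.
have [w' [wD w'E]] := is_weak_derive_pointwise xlr hd.
have ip_w' j (phi : Vh R N k) :
    ip x j (fun y => derive1 (fun tau => ev (w tau) j y) t) (ev phi j) =
    ip x j (ev (toVh w') j) (ev phi j).
  by apply: eq_Rintegral => y; rewrite inE => /w'E->.
have G_bil : bilinear_form G := l2_bilinear k xlr.
have bm_bil : bilinear_form bm := weak_dx_bilinear k xlr gm_lin.
have bq_bil : bilinear_form bq := weak_dx_bilinear k xlr gq_lin.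
have G_sym y z : G y z = G z y by exact: l2_sym.
have G_ge0 y : 0 <= G y y by exact: l2_ge0.
have G_def y : G y y = 0 -> y = 0 by exact: l2_definite.
have b_dual y z : bm y z = - bq z y by exact: weak_dual.
have w'_eq z : G w' z + G (ofVh (s t)) z = bm (ofVh (ph t)) z.
  rewrite /G /bm !ofVhK /l2 /weak_dx -big_split; apply: eq_bigr => j _ /=.
  have [_ _ + _ _] := hs j (toVh z) (toVh z) (toVh z) (toVh z) (toVh z).
  by rewrite ip_w'.
have p_eq z : G (ofVh (ph t)) z = bq (ofVh (s t)) z - G (ofVh (u t)) z.
  rewrite /G /bq !ofVhK /l2 /weak_dx -sumrB; apply: eq_bigr => j _ /=.
  by have [_ _ _ + _] := hs j (toVh z) (toVh z) (toVh z) (toVh z) (toVh z).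
have l2su : l2 x (s t) (u t) =
    \sum_(j < N) (F (trp x (u t) j) - F (trm x (u t) j)
               - hat x gf (u t) j * (trp x (u t) j - trm x (u t) j)).
  apply: (nonlinear_flux_energy xlr cf hF) => // j.
  by have [_ _ _ _ +] := hs j (u t) (u t) (u t) (u t) (u t).
split.
  have one_scalar : scalar (fun z : Space => l2 x (toVh z) (@oneVh R N k)).
    have [+ _] := l2_bilinear k xlr => /(_ (ofVh (@oneVh R N k))).
    by rewrite ofVhK.
  rewrite [X in is_derive _ _ X _](_ : _ =
    fun tau => l2 x (toVh (ofVh (w tau))) (@oneVh R N k)); last first.
    by apply/funext => tau; rewrite ofVhK E1_l2.
  apply: is_derive_eq; first exact: (wD _ one_scalar).
  pose o := @oneVh R N k.
  have s0 : l2 x (s t) o = 0.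
    rewrite -(@sum_bdry_one R N k x (hat x gf (u t))); apply: eq_bigr => j _.
    by have [_ _ _ _ ->] := hs j o o o o o; rewrite ip_dx_one subr0.
  (* Adding the mean of s, which is zero, makes the third equation apply, and
     its right-hand side telescopes. *)
  rewrite -[LHS]addr0 -[X in _ + X]s0.
  rewrite -[RHS](@sum_bdry_one R N k x (hat x gm (ph t))).
  rewrite -big_split; apply: eq_bigr => j _ /=.
  have [_ _ + _ _] := hs j o o o o o.
  by rewrite ip_w' ip_dx_one subr0.
have [S [T [hST S_lin]]] :=
  helmholtz_solver G_bil bm_bil bq_bil G_ge0 G_def b_dual.
(* Uniqueness identifies u with S w on all of ]t0, t1[, so u inherits the
   differentiability of w. *)
have uD : is_weak_derive (fun tau => ofVh (u tau)) t (S w').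
  apply: (is_weak_derive_linear S_lin wD).
  have tI : t \in `]t0, t1[ by rewrite in_itv.
  apply: filterS (near_in_itvoo tI) => tau; rewrite in_itv /= => htau.
  by have [] := helmholtz_unique G_bil bm_bil bq_bil G_ge0 G_def b_dual
    (scheme_helmholtz htau) (hST (ofVh (w tau))).
have [v [q Gu]] := energy_identity G_bil bm_bil bq_bil G_sym G_ge0 G_def b_dual
  (hST w') w'_eq p_eq.
exists (toVh v), (toVh q).
rewrite -l2su; have := is_weak_derive_quadratic G_bil G_sym uD.
rewrite Gu /G !ofVhK => /(@near_eq_is_derive _ _ _ _ _ _ _ _); apply.
by near=> tau; rewrite !ofVhK E2_l2.
Unshelve. all: by end_near. Qed.

End EnergyRate.

(** * Mass conservation and energy of the two schemes *)

Lemma linear_flux_minus (R : realType) : linear_flux (@flux_minus R).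
Proof. by []. Qed.

Lemma linear_flux_plus (R : realType) : linear_flux (@flux_plus R).
Proof. by []. Qed.

Lemma linear_flux_avg (R : realType) : linear_flux (@flux_avg R).
Proof. by move=> c um up vm vp; rewrite /flux_avg; field. Qed.

Theorem proposition3p1 (R : realType) (p : nat) (hp : (2 <= p)%N)
    (f : R -> R) (hf : forall v : R, f v = p%:R^-1 * v ^+ p)
    (F : R -> R) (hF : antiderivative f F)
    (a b : R) (N k : nat) (hN : (0 < N)%N)
    (x : 'I_N.+1 -> R) (hx : is_mesh a b x)
    (t0 t1 : R) (u r w ph s : R -> Vh R N k) :
  (scheme_D2 x f t0 t1 u r w ph s ->
   forall t : R, t0 < t < t1 ->
     is_derive t 1 (fun tau => E1 x (w tau)) 0 /\
     (derivable (fun tau => E2 x (u tau)) t 1 /\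
      derive1 (fun tau => E2 x (u tau)) t <= 0)) /\
  (scheme_C2 x f F t0 t1 u r w ph s ->
   forall t : R, t0 < t < t1 ->
     is_derive t 1 (fun tau => E1 x (w tau)) 0 /\
     is_derive t 1 (fun tau => E2 x (u tau)) 0).
Proof.
have xlr j : xl x j < xr x j by exact: mesh_cell hx.
have cf : continuous f.
  have -> : f = horner (p%:R^-1 *: 'X^p).
    by apply/funext => y; rewrite hf !hornerE.
  exact: continuous_horner.
split=> sol t ht.
  have [e1 [v [q [dE2 E2']]]] := ldg_rates xlr cf hF
    (@linear_flux_minus R) (@linear_flux_plus R)
    (weak_dx_dual_alternating xlr) sol ht.
  split=> //; split=> //; rewrite derive1E E2'.
  have v_ge0 := weak_dx_upwind_ge0 xlr v.
  have q_ge0 := weak_dx_upwind_ge0 xlr q.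
  set sigma := \sum_(j < N) _; have : 0 <= sigma; last by lra.
  by apply: sumr_ge0 => j _; exact: godunov_dissipative.
have [e1 [v [q E2']]] := ldg_rates xlr cf hF
  (@linear_flux_avg R) (@linear_flux_avg R)
  (weak_dx_dual_central xlr) sol ht.
split=> //; apply: (is_derive_eq E2').
rewrite !weak_dx_central_eq0 // big1 ?oppr0 ?addr0 ?mulr0 // => j _.
exact: conservative_neutral.
Qed.
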